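(* Let $E$ be a Gysin functor on a finitary lextensive category $\mathcal{C}$, and let $\mathcal{C}_E$ be its category of correspondences. Every map in $\mathcal{C}_E$ can be written as a sum of maps of the form $Rf\circ Da\circ Ig$ (with $f\colon Z\to Y$, $g\colon Z\to X$ maps in $\mathcal{C}$ and $a\in E(Z)$). Other composites of the maps $R(-)$, $D(-)$, $I(-)$ can be rewritten in this form using the following rules, which hold in $\mathcal{C}_E$: (a) $Da\circ Rf=Rf\circ D(f^*a)$ for $f\colon X\to Y$ in $\mathcal{C}$ and $a\in E(Y)$; (b) $If\circ Da=D(f^*a)\circ If$ for $f\colon X\to Y$ in $\mathcal{C}$ and $a\in E(Y)$; (c) $If\circ Rg=Rp\circ Iq$ for $f\colon B\to C$ and $g\colon A\to C$ in $\mathcal{C}$, where $q\colon P\to A$ and $p\colon P\to B$ are the maps in the pullback square $P=B\times_C A$ in $\mathcal{C}$ (so $gq=fp$). Moreover, for a map $f\colon X\to Y$ in $\mathcal{C}$ and $a\in E(X)$ one has $Rf\circ Da\circ If=D(f_!(a))$.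
   Context: Finitary lextensive category: a category $\mathcal{C}$ with finite limits and finite coproducts such that (i) for all maps $A\to X$, $P_1\to X$, $P_2\to X$ the natural map $(A\times_X P_1)\amalg (A\times_X P_2)\to A\times_X(P_1\amalg P_2)$ is an isomorphism; (ii) for all objects $A,B$, with coproduct inclusions $i_0\colon A\to A\amalg B$, $i_1\colon B\to A\amalg B$, one has that $A$ (with identity maps) is the pullback of $A\xrightarrow{i_0}A\amalg B\xleftarrow{i_0}A$, $B$ (with identity maps) is the pullback of $B\xrightarrow{i_1}A\amalg B\xleftarrow{i_1}B$, and $\emptyset$ is the pullback of $A\xrightarrow{i_0}A\amalg B\xleftarrow{i_1}B$. Gysin functor on $\mathcal{C}$: a contravariant functor $E$ from $\mathcal{C}$ to commutative rings together with a covariant functor $\tilde E$ from $\mathcal{C}$ to abelian groups with $\tilde E(X)=E(X)$ (as abelian groups) for all $X$. For $f\colon X\to Y$ write $f^*=E(f)\colon E(Y)\to E(X)$ and $f_!=\tilde E(f)\colon E(X)\to E(Y)$; for $a\in E(X)$, $b\in E(Y)$ write $a\otimes b=(\pi_X)^*(a)\cdot(\pi_Y)^*(b)\in E(X\times Y)$, with $\pi_X,\pi_Y$ the projections of $X\times Y$. Axioms: (1) $E(\emptyset)=0$; (2) $(i_X^*,i_Y^* )\colon E(X\amalg Y)\to E(X)\times E(Y)$ is an isomorphism of rings; (3) $(f\times g)_!(a\otimes b)=f_!(a)\otimes g_!(b)$ for all $f\colon X\to X'$, $g\colon Y\to Y'$, $a\in E(X)$, $b\in E(Y)$; (4) for every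 pullback square with $f\colon A\to B$, $p\colon A\to C$, $q\colon B\to D$, $g\colon C\to D$ ($qf=gp$), one has $f_!p^*=q^*g_!$. The category $\mathcal{C}_E$ of $E$-correspondences: same objects as $\mathcal{C}$; $\mathcal{C}_E(A,B)=E(B\times A)$ as abelian group; the composite of $\beta\in\mathcal{C}_E(A,B)$ and $\alpha\in\mathcal{C}_E(B,C)$ is $\alpha\circ\beta=(\pi_{13})_!\big(\pi_{12}^*(\alpha)\cdot\pi_{23}^*(\beta)\big)$, with $\pi_{12},\pi_{13},\pi_{23}$ the projections from $C\times B\times A$ to $C\times B$, $C\times A$, $B\times A$; the identity of $A$ is $i_A=(\Delta_A)_!(1)\in E(A\times A)$, with $\Delta_A\colon A\to A\times A$ the diagonal. For $f\colon A\to B$ in $\mathcal{C}$: $Rf=R_f=(\mathrm{id}_B\times f)^*(i_B)\in E(B\times A)=\mathcal{C}_E(A,B)$ and $If=I_f=(f\times\mathrm{id}_B)^*(i_B)\in E(A\times B)=\mathcal{C}_E(B,A)$. For $a\in E(X)$: $Da=D_a=(\Delta_X)_!(a)\in E(X\times X)=\mathcal{C}_E(X,X)$. *)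

(* Defs.v *)
From HB Require Import structures.
From mathcomp Require Import all_boot all_algebra.
Set Implicit Arguments.
Unset Strict Implicit.
Unset Printing Implicit Defensive.
Import GRing.Theory.
Local Open Scope ring_scope.

Record category := Category {
  obj :> Type;
  mor : obj -> obj -> Type;
  idc : forall A, mor A A;
  cmp : forall A B C, mor B C -> mor A B -> mor A C;
  cmpA : forall A B C D (h : mor C D) (g : mor B C) (f : mor A B),
    cmp h (cmp g f) = cmp (cmp h g) f;
  cmp1f : forall A B (f : mor A B), cmp (idc B) f = f;
  cmpf1 : forall A B (f : mor A B), cmp f (idc A) = f
}.
Arguments mor {c} A B.
Arguments idc {c} A.
Arguments cmp {c A B C} g f.
Notation "g ∘ f" := (cmp g f) (at level 40, left associativity).

Record functor (J C : category) := Functor {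
  fobj :> J -> C;
  fmap : forall i j, mor i j -> mor (fobj i) (fobj j);
  fmap1 : forall i, fmap (idc i) = idc (fobj i);
  fmapM : forall i j k (v : mor j k) (u : mor i j),
    fmap (v ∘ u) = fmap v ∘ fmap u
}.

Definition is_finite (T : Type) : Prop :=
  exists (n : nat) (e : 'I_n -> T), bijective e.

Definition is_finite_category (J : category) : Prop :=
  is_finite J /\ forall i j : J, is_finite (mor i j).

Section Universal.
Variable C : category.

Definition is_iso (A B : C) (f : mor A B) : Prop :=
  exists g : mor B A, g ∘ f = idc A /\ f ∘ g = idc B.

Definition is_cone (J : category) (F : functor J C) (L : C)
    (l : forall j, mor L (F j)) : Prop :=
  forall i j (u : mor i j), fmap F u ∘ l i = l j.

Definition is_limit (J : category) (F : functor J C) (L : C)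
    (l : forall j, mor L (F j)) : Prop :=
  is_cone l /\
  forall (T : C) (t : forall j, mor T (F j)), is_cone t ->
    exists! h : mor T L, forall j, l j ∘ h = t j.

Definition has_finite_limits : Prop :=
  forall (J : category) (F : functor J C), is_finite_category J ->
    exists (L : C) (l : forall j, mor L (F j)), is_limit l.

Definition has_finite_coproducts : Prop :=
  forall (I : finType) (F : I -> C),
    exists (S : C) (s : forall i, mor (F i) S),
      forall (T : C) (t : forall i, mor (F i) T),
        exists! h : mor S T, forall i, h ∘ s i = t i.

Definition is_initial (Z : C) : Prop :=
  forall A : C, exists! f : mor Z A, True.

Definition is_coproduct (A B S : C) (i : mor A S) (j : mor B S) : Prop :=
  forall (T : C) (u : mor A T) (v : mor B T),
    exists! h : mor S T, h ∘ i = u /\ h ∘ j = v.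

(*      p2
     P ----> B
  p1 |       | g
     A ----> X
         f           *)
Definition is_pullback (A B X P : C) (p1 : mor P A) (p2 : mor P B)
    (f : mor A X) (g : mor B X) : Prop :=
  f ∘ p1 = g ∘ p2 /\
  forall (T : C) (u : mor T A) (v : mor T B), f ∘ u = g ∘ v ->
    exists! h : mor T P, p1 ∘ h = u /\ p2 ∘ h = v.

(* [h] is the natural map from (A x_X P1) + (A x_X P2) = S to
   A x_X (P1 + P2) = R, characterised by its composites with the coproduct
   inclusions [s1], [s2] and the pullback projections [r], [r']. *)
Definition coproducts_stable_under_pullback : Prop :=
  forall (X A P1 P2 P Q1 Q2 S R : C)
    (a : mor A X) (p1 : mor P1 X) (p2 : mor P2 X)
    (j1 : mor P1 P) (j2 : mor P2 P) (p : mor P X)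
    (q1 : mor Q1 A) (q1' : mor Q1 P1) (q2 : mor Q2 A) (q2' : mor Q2 P2)
    (s1 : mor Q1 S) (s2 : mor Q2 S) (r : mor R A) (r' : mor R P)
    (h : mor S R),
  is_coproduct j1 j2 -> p ∘ j1 = p1 -> p ∘ j2 = p2 ->
  is_pullback q1 q1' a p1 -> is_pullback q2 q2' a p2 ->
  is_coproduct s1 s2 -> is_pullback r r' a p ->
  r ∘ (h ∘ s1) = q1 -> r' ∘ (h ∘ s1) = j1 ∘ q1' ->
  r ∘ (h ∘ s2) = q2 -> r' ∘ (h ∘ s2) = j2 ∘ q2' ->
  is_iso h.

Definition coproducts_disjoint : Prop :=
  forall (A B S : C) (i0 : mor A S) (i1 : mor B S), is_coproduct i0 i1 ->
  [/\ is_pullback (idc A) (idc A) i0 i0,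
      is_pullback (idc B) (idc B) i1 i1 &
      forall (Z : C) (u : mor Z A) (v : mor Z B),
        is_initial Z -> is_pullback u v i0 i1].

End Universal.

(* Binary products exist by [lx_limits]; [cprod] and its structure maps fix a
   choice of them, needed to form E(B x A).  All other limits and colimits are
   used through their universal properties only. *)
Record lextensive_category := LextensiveCategory {
  lx_cat :> category;
  lx_limits : has_finite_limits lx_cat;
  lx_coproducts : has_finite_coproducts lx_cat;
  lx_stable : coproducts_stable_under_pullback lx_cat;
  lx_disjoint : coproducts_disjoint lx_cat;
  cprod : lx_cat -> lx_cat -> lx_cat;
  pr1 : forall A B, mor (cprod A B) A;
  pr2 : forall A B, mor (cprod A B) B;
  pair_map : forall T A B, mor T A -> mor T B -> mor T (cprod A B);
  pr1_pair : forall T A B (u : mor T A) (v : mor T B),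
    pr1 A B ∘ pair_map u v = u;
  pr2_pair : forall T A B (u : mor T A) (v : mor T B),
    pr2 A B ∘ pair_map u v = v;
  pair_ext : forall T A B (h h' : mor T (cprod A B)),
    pr1 A B ∘ h = pr1 A B ∘ h' -> pr2 A B ∘ h = pr2 A B ∘ h' -> h = h'
}.
Arguments cprod {l} A B.
Arguments pr1 {l A B}.
Arguments pr2 {l A B}.
Arguments pair_map {l T A B} u v.
Notation "A ⊠ B" := (cprod A B) (at level 40, left associativity).
Notation "⟨ u , v ⟩" := (pair_map u v) (at level 0, u, v at level 99).

Definition prod_map (C : lextensive_category) (A A' B B' : C)
    (f : mor A A') (g : mor B B') : mor (A ⊠ B) (A' ⊠ B') :=
  ⟨f ∘ pr1, g ∘ pr2⟩.

Definition diag (C : lextensive_category) (A : C) : mor A (A ⊠ A) :=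
  ⟨idc A, idc A⟩.

(* Rings are [comPzRingType]s since E(0) is the zero ring.  [pull] and [push]
   share their value on objects, so that E and its covariant companion have the
   same underlying additive groups by construction. *)
Record gysin_functor (C : lextensive_category) := GysinFunctor {
  gobj :> C -> comPzRingType;
  pull : forall X Y : C, mor X Y -> {rmorphism gobj Y -> gobj X};
  push : forall X Y : C, mor X Y -> {additive gobj X -> gobj Y};
  pull1 : forall (X : C) (a : gobj X), pull (idc X) a = a;
  pullM : forall (X Y Z : C) (g : mor Y Z) (f : mor X Y) (a : gobj Z),
    pull (g ∘ f) a = pull f (pull g a);
  push1 : forall (X : C) (a : gobj X), push (idc X) a = a;
  pushM : forall (X Y Z : C) (g : mor Y Z) (f : mor X Y) (a : gobj X),
    push (g ∘ f) a = push g (push f a);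
  gysin_initial : forall Z : C, is_initial Z -> forall a : gobj Z, a = 0;
  gysin_coproduct : forall (X Y S : C) (i : mor X S) (j : mor Y S),
    is_coproduct i j ->
    bijective (fun c : gobj S => (pull i c, pull j c));
  gysin_tensor : forall (X X' Y Y' : C) (f : mor X X') (g : mor Y Y')
      (a : gobj X) (b : gobj Y),
    push (prod_map f g) (pull pr1 a * pull pr2 b)
    = pull pr1 (push f a) * pull pr2 (push g b);
  gysin_base_change : forall (A B X D : C)
      (f : mor A B) (p : mor A X) (q : mor B D) (g : mor X D),
    is_pullback f p q g ->
    forall c : gobj X, push f (pull p c) = pull q (push g c)
}.
Arguments pull {C} g0 {X Y} f : rename.
Arguments push {C} g0 {X Y} f : rename.

Section Correspondences.
Variables (C : lextensive_category) (E : gysin_functor C).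

Definition corr (A B : C) : comPzRingType := E (B ⊠ A).

(* C x B x A is bracketed as C x (B x A). *)
Definition corr_comp (A B D : C) (alpha : corr B D) (beta : corr A B) :
    corr A D :=
  push E (⟨pr1, pr2 ∘ pr2⟩ : mor (D ⊠ (B ⊠ A)) (D ⊠ A))
    (pull E (⟨pr1, pr1 ∘ pr2⟩ : mor (D ⊠ (B ⊠ A)) (D ⊠ B)) alpha
     * pull E (pr2 : mor (D ⊠ (B ⊠ A)) (B ⊠ A)) beta).

Definition corr_id (A : C) : corr A A := push E (diag A) 1.

Definition Rmap (A B : C) (f : mor A B) : corr A B :=
  pull E (prod_map (idc B) f) (corr_id B).

Definition Imap (A B : C) (f : mor A B) : corr B A :=
  pull E (prod_map f (idc B)) (corr_id B).

Definition Dmap (X : C) (a : E X) : corr X X := push E (diag X) a.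

End Correspondences.
Arguments corr_comp {C E A B D} alpha beta.
Arguments Rmap {C} E {A B} f.
Arguments Imap {C} E {A B} f.
Arguments Dmap {C} E {X} a.
Notation "alpha ⊚ beta" := (corr_comp alpha beta)
  (at level 40, left associativity).

Inductive RDI_composite (C : lextensive_category) (E : gysin_functor C) :
    forall X Y : C, corr E X Y -> Prop :=
| RDI_R (X Y : C) (f : mor X Y) : RDI_composite (Rmap E f)
| RDI_D (X : C) (a : E X) : RDI_composite (Dmap E a)
| RDI_I (X Y : C) (f : mor X Y) : RDI_composite (Imap E f)
| RDI_comp (X Y Z : C) (alpha : corr E Y Z) (beta : corr E X Y) :
    RDI_composite alpha -> RDI_composite beta ->
    RDI_composite (alpha ⊚ beta).

Section CorrespondenceCategory.
Variables (C : lextensive_category) (E : gysin_functor C).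

Lemma pair_pre (T S A B : C) (u : mor T A) (v : mor T B) (h : mor S T) :
  ⟨u, v⟩ ∘ h = ⟨u ∘ h, v ∘ h⟩.
Proof. by apply: pair_ext; rewrite cmpA ?pr1_pair ?pr2_pair. Qed.

Lemma pr1_pairA (T S A B : C) (u : mor T A) (v : mor T B) (h : mor S T) :
  pr1 ∘ (⟨u, v⟩ ∘ h) = u ∘ h.
Proof. by rewrite cmpA pr1_pair. Qed.

Lemma pr2_pairA (T S A B : C) (u : mor T A) (v : mor T B) (h : mor S T) :
  pr2 ∘ (⟨u, v⟩ ∘ h) = v ∘ h.
Proof. by rewrite cmpA pr2_pair. Qed.

Lemma pair_map_inj (T A B : C) (u u' : mor T A) (v v' : mor T B) :
  ⟨u, v⟩ = ⟨u', v'⟩ -> u = u' /\ v = v'.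
Proof.
move=> e; split.
- by rewrite -(pr1_pair u v) e pr1_pair.
- by rewrite -(pr2_pair u v) e pr2_pair.
Qed.

Lemma pair_eta (T A B : C) (h : mor T (A ⊠ B)) : ⟨pr1 ∘ h, pr2 ∘ h⟩ = h.
Proof. by apply: pair_ext; rewrite ?pr1_pair ?pr2_pair. Qed.

Lemma pair_id (A B : C) : ⟨pr1, pr2⟩ = idc (A ⊠ B).
Proof. by rewrite -[RHS]pair_eta !cmpf1. Qed.

Let simp := (pair_pre, pr1_pairA, pr2_pairA, pr1_pair, pr2_pair, cmp1f, cmpf1).

Lemma projection_formula (A B : C) (f : mor A B) (a : E A) (b : E B) :
  push E f (a * pull E f b) = push E f a * b.
Proof.
have pb : is_pullback f ⟨idc A, f⟩ (diag B) (prod_map f (idc B)).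
  split; first by rewrite /diag /prod_map !(simp, =^~ cmpA).
  move=> T u w; rewrite /diag /prod_map !(simp, =^~ cmpA) => /pair_map_inj[e1 e2].
  exists (pr1 ∘ w); split.
    split; first by rewrite e1.
    by rewrite !(simp, =^~ cmpA) -e1 e2 pair_eta.
  by move=> h [_ <-]; rewrite !simp.
have := gysin_base_change pb (pull E pr1 a * pull E pr2 b).
rewrite gysin_tensor push1 !rmorphM -!pullM /diag !simp.
by rewrite !pull1.
Qed.

Lemma corr_comp1f (A B : C) (alpha : corr E A B) : corr_id E B ⊚ alpha = alpha.
Proof.
rewrite /corr_comp /corr_id.
have pb : is_pullback (⟨pr1, idc (B ⊠ A)⟩ : mor (B ⊠ A) (B ⊠ (B ⊠ A)))
            pr1 ⟨pr1, pr1 ∘ pr2⟩ (diag B).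
  split; first by rewrite /diag !(simp, =^~ cmpA).
  move=> T u v; rewrite /diag !(simp, =^~ cmpA) => /pair_map_inj[e1 e2].
  exists (pr2 ∘ u); split.
    rewrite !simp e2; split=> //.
    by rewrite -[RHS]pair_eta e1.
  by move=> h [<- _]; rewrite !simp.
rewrite -(gysin_base_change pb) -projection_formula -pushM -pullM rmorph1.
by rewrite mul1r !(simp, =^~ cmpA) pair_id push1 pull1.
Qed.

Lemma corr_compf1 (A B : C) (alpha : corr E A B) : alpha ⊚ corr_id E A = alpha.
Proof.
rewrite /corr_comp /corr_id.
have pb : is_pullback (⟨pr1, ⟨pr2, pr2⟩⟩ : mor (B ⊠ A) (B ⊠ (A ⊠ A)))
            pr2 pr2 (diag A).
  split; first by rewrite /diag !(simp, =^~ cmpA).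
  move=> T u v; rewrite /diag !(simp, =^~ cmpA) => e.
  exists ⟨pr1 ∘ u, v⟩; split.
    rewrite !simp; split=> //.
    by rewrite -[RHS]pair_eta e.
  move=> h [<- <-]; rewrite !simp.
  by rewrite pair_eta.
rewrite -(gysin_base_change pb) mulrC -projection_formula -pushM rmorph1.
by rewrite mul1r -pullM !(simp, =^~ cmpA) pair_id push1 pull1.
Qed.

Lemma corr_compA (A B X D : C) (gamma : corr E X D) (beta : corr E B X)
    (alpha : corr E A B) :
  gamma ⊚ (beta ⊚ alpha) = (gamma ⊚ beta) ⊚ alpha.
Proof.
rewrite /corr_comp.
have pbl : is_pullback
    (⟨pr1, ⟨pr1 ∘ pr2, pr2 ∘ (pr2 ∘ pr2)⟩⟩ :
       mor (D ⊠ (X ⊠ (B ⊠ A))) (D ⊠ (X ⊠ A)))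
    pr2 pr2 ⟨pr1, pr2 ∘ pr2⟩.
  split; first by rewrite !(simp, =^~ cmpA).
  move=> T u v; rewrite !(simp, =^~ cmpA) => e.
  exists ⟨pr1 ∘ u, v⟩; split.
    rewrite !(simp, =^~ cmpA); split=> //.
    by rewrite -[RHS]pair_eta e.
  by move=> h [<- <-]; rewrite !(simp, =^~ cmpA) pair_eta.
have pbr : is_pullback
    (⟨pr1, pr2 ∘ pr2⟩ : mor (D ⊠ (X ⊠ (B ⊠ A))) (D ⊠ (B ⊠ A)))
    ⟨pr1, ⟨pr1 ∘ pr2, pr1 ∘ (pr2 ∘ pr2)⟩⟩
    ⟨pr1, pr1 ∘ pr2⟩ ⟨pr1, pr2 ∘ pr2⟩.
  split; first by rewrite !(simp, =^~ cmpA).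
  move=> T u v; rewrite !(simp, =^~ cmpA) => /pair_map_inj[e1 e2].
  exists ⟨pr1 ∘ u, ⟨pr1 ∘ (pr2 ∘ v), pr2 ∘ u⟩⟩; split.
    rewrite !(simp, =^~ cmpA) e1 e2 !pair_eta; split=> //.
    by rewrite -e1 pair_eta.
  move=> h [<- <-]; rewrite !(simp, =^~ cmpA).
  by rewrite !pair_eta.
rewrite -(gysin_base_change pbl) -(gysin_base_change pbr).
rewrite mulrC -!projection_formula -!pushM !rmorphM -!pullM !(simp, =^~ cmpA).
by rewrite [LHS]/= mulrC mulrA.
Qed.

Definition corr_category : category :=
  @Category C (fun A B => corr E A B) (corr_id E) (@corr_comp C E)
    (fun A B X D gamma beta alpha => corr_compA gamma beta alpha)
    corr_comp1f corr_compf1.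

End CorrespondenceCategory.

(* Main.v *)
Require Import Defs.
From mathcomp Require Import all_boot all_algebra.
Import GRing.Theory.
Local Open Scope ring_scope.

(** A span X <-g- Z -f-> Y with a class a in E(Z) on its apex determines the
correspondence [span_corr f g a], the push-forward of a along
<f,g> : Z -> Y x X.  The generators are the three degenerate cases
([Rmap_span], [Dmap_span], [Imap_span]):

    Rf = (f, id, 1),    Da = (id, id, a),    Ig = (id, g, 1),

and correspondences of spans compose as the spans do: one takes the pullback of
the two inner legs (the maps to the middle object), restricts both classes to
it and multiplies them ([span_corr_comp]).  This is where the Gysin axioms enter, as two base changes
and two uses of the projection formula.

Each rewriting rule is now the observation that both sides come from the same
span.  All pullbacks needed have an identity among the two maps
([is_pullback_id_l], [is_pullback_id_r]), except for If Rg, where the given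
pullback square is used.  In particular Rf Da Ig = (f, g, a)
([Rmap_Dmap_Imap]).

Hence an arbitrary u in E(Y x X) is R(pr1) Du I(pr2), since <pr1,pr2> is the
identity of Y x X.  This single term serves both as the sum and as the normal
form of a composite of generators.  Finally Rf Da If is the
push-forward of a along <f,f> = diag o f, that is D(f_! a). *)

Section SpanCorrespondences.

Set Implicit Arguments.
Unset Strict Implicit.

Variables (C : lextensive_category) (E : gysin_functor C).

Let simp := (pair_pre, pr1_pairA, pr2_pairA, pr1_pair, pr2_pair, cmp1f, cmpf1).

Definition span_corr (X Y Z : C) (f : mor Z Y) (g : mor Z X) (a : E Z) :
    corr E X Y :=
  push E ⟨f, g⟩ a.

Lemma is_pullback_id_l (A B : C) (f : mor A B) :
  is_pullback f (idc A) (idc B) f.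
Proof.
split; first by rewrite !simp.
move=> T u v; rewrite !simp => e; exists v; split; first by rewrite simp.
by move=> h [_ <-]; rewrite simp.
Qed.

Lemma is_pullback_id_r (A B : C) (f : mor A B) :
  is_pullback (idc A) f f (idc B).
Proof.
split; first by rewrite !simp.
move=> T u v; rewrite !simp => e; exists u; split; first by rewrite simp.
by move=> h [<- _]; rewrite simp.
Qed.

(** Base change of the diagonal along id x f, whose pullback is the graph. *)
Lemma Rmap_span (X Y : C) (f : mor X Y) : Rmap E f = span_corr f (idc X) 1.
Proof.
rewrite /Rmap /corr_id /span_corr.
have pb : is_pullback ⟨f, idc X⟩ f (prod_map (idc Y) f) (diag Y).
  split; first by rewrite /diag /prod_map !(simp, =^~ cmpA).
  move=> T u v; rewrite /diag /prod_map !(simp, =^~ cmpA).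
  move=> /pair_map_inj[e1 e2]; exists (pr2 ∘ u); split.
    by rewrite !simp e2 -e1 pair_eta.
  by move=> h [<- _]; rewrite !simp.
by rewrite -(gysin_base_change pb) rmorph1.
Qed.

Lemma Imap_span (X Y : C) (f : mor X Y) : Imap E f = span_corr (idc X) f 1.
Proof.
rewrite /Imap /corr_id /span_corr.
have pb : is_pullback ⟨idc X, f⟩ f (prod_map f (idc Y)) (diag Y).
  split; first by rewrite /diag /prod_map !(simp, =^~ cmpA).
  move=> T u v; rewrite /diag /prod_map !(simp, =^~ cmpA).
  move=> /pair_map_inj[e1 e2]; exists (pr1 ∘ u); split.
    by rewrite !simp e1 -e2 pair_eta.
  by move=> h [<- _]; rewrite !simp.
by rewrite -(gysin_base_change pb) rmorph1.
Qed.

Lemma Dmap_span (X : C) (a : E X) : Dmap E a = span_corr (idc X) (idc X) a.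
Proof. by []. Qed.

(** Both factors of the product defining the composite are restrictions of
push-forwards.  The first is moved to Z x A by base change, then the second,
restricted along g x id : Z x A -> B x A, is moved to the pullback P; the
projection formula brings the product inside at each stage. *)
Lemma span_corr_comp (A B D Z W P : C) (f : mor Z D) (g : mor Z B) (a : E Z)
    (h : mor W B) (k : mor W A) (b : E W) (p : mor P Z) (q : mor P W) :
  is_pullback p q g h ->
  span_corr f g a ⊚ span_corr h k b
  = span_corr (f ∘ p) (k ∘ q) (pull E p a * pull E q b).
Proof.
move=> [pq_comm pq_univ]; rewrite /corr_comp /span_corr.
have pb1 : is_pullback
    (⟨f ∘ pr1, ⟨g ∘ pr1, pr2⟩⟩ : mor (Z ⊠ A) (D ⊠ (B ⊠ A)))
    pr1 ⟨pr1, pr1 ∘ pr2⟩ ⟨f, g⟩.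
  split; first by rewrite !(simp, =^~ cmpA).
  move=> T u v; rewrite !(simp, =^~ cmpA) => /pair_map_inj[e1 e2].
  exists ⟨v, pr2 ∘ (pr2 ∘ u)⟩; split.
    by rewrite !(simp, =^~ cmpA) -e1 -e2 !pair_eta.
  by move=> l [<- <-]; rewrite !(simp, =^~ cmpA) pair_eta.
have pb2 : is_pullback (⟨p, k ∘ q⟩ : mor P (Z ⊠ A)) q
    ⟨g ∘ pr1, pr2⟩ ⟨h, k⟩.
  split; first by rewrite !(simp, =^~ cmpA) pq_comm.
  move=> T u v; rewrite !(simp, =^~ cmpA) => /pair_map_inj[e1 e2].
  have [l [[l1 l2] l_uniq]] := pq_univ _ _ _ e1.
  exists l; split.
    by rewrite !(simp, =^~ cmpA) l1 l2 -e2 pair_eta.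
  move=> l' [l'1 l'2]; apply: l_uniq; split=> //.
  by rewrite -l'1 !simp.
rewrite -(gysin_base_change pb1) -projection_formula -pullM simp.
rewrite -(gysin_base_change pb2) [_ * push _ _ _]mulrC -projection_formula.
by rewrite -!pushM -pullM !(simp, =^~ cmpA) mulrC.
Qed.

Lemma Rmap_Dmap (X Y : C) (f : mor X Y) (a : E X) :
  Rmap E f ⊚ Dmap E a = span_corr f (idc X) a.
Proof.
rewrite Rmap_span Dmap_span (span_corr_comp _ _ _ _ (is_pullback_id_l (idc X))).
by rewrite rmorph1 mul1r pull1 !simp.
Qed.

Lemma Rmap_Dmap_Imap (X Y Z : C) (f : mor Z Y) (g : mor Z X) (a : E Z) :
  Rmap E f ⊚ Dmap E a ⊚ Imap E g = span_corr f g a.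
Proof.
rewrite Rmap_Dmap Imap_span.
rewrite (span_corr_comp _ _ _ _ (is_pullback_id_l (idc Z))).
by rewrite rmorph1 mulr1 pull1 !simp.
Qed.

(** The class u itself, on the span formed by the two projections of Y x X. *)
Lemma corr_RDI (X Y : C) (u : corr E X Y) :
  u = Rmap E pr1 ⊚ Dmap E (u : E (Y ⊠ X)) ⊚ Imap E pr2.
Proof. by rewrite Rmap_Dmap_Imap /span_corr pair_id push1. Qed.

Lemma Dmap_Rmap (X Y : C) (f : mor X Y) (a : E Y) :
  Dmap E a ⊚ Rmap E f = Rmap E f ⊚ Dmap E (pull E f a).
Proof.
rewrite Rmap_Dmap Rmap_span Dmap_span.
rewrite (span_corr_comp _ _ _ _ (is_pullback_id_l f)).
by rewrite rmorph1 mulr1 !simp.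
Qed.

Lemma Imap_Dmap (X Y : C) (f : mor X Y) (a : E Y) :
  Imap E f ⊚ Dmap E a = Dmap E (pull E f a) ⊚ Imap E f.
Proof.
rewrite Imap_span !Dmap_span.
rewrite (span_corr_comp _ _ _ _ (is_pullback_id_r f)).
rewrite (span_corr_comp _ _ _ _ (is_pullback_id_l (idc X))).
by rewrite !rmorph1 mul1r mulr1 pull1 !simp.
Qed.

Lemma Imap_Rmap (A B D P : C) (f : mor B D) (g : mor A D)
    (p : mor P B) (q : mor P A) :
  is_pullback p q f g -> Imap E f ⊚ Rmap E g = Rmap E p ⊚ Imap E q.
Proof.
move=> pb; rewrite !Imap_span !Rmap_span (span_corr_comp _ _ _ _ pb).
rewrite (span_corr_comp _ _ _ _ (is_pullback_id_l (idc P))).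
by rewrite !rmorph1 !simp.
Qed.

Lemma Rmap_Dmap_Imap_push (X Y : C) (f : mor X Y) (a : E X) :
  Rmap E f ⊚ Dmap E a ⊚ Imap E f = Dmap E (push E f a).
Proof. by rewrite Rmap_Dmap_Imap /Dmap -pushM /diag !simp. Qed.

End SpanCorrespondences.

Theorem theorem1p2 (C : lextensive_category) (E : gysin_functor C) :
  (forall (X Y : C) (u : corr E X Y),
     exists (n : nat) (Z : 'I_n -> C) (f : forall i, mor (Z i) Y)
       (g : forall i, mor (Z i) X) (a : forall i, E (Z i)),
       u = \sum_(i < n) Rmap E (f i) ⊚ Dmap E (a i) ⊚ Imap E (g i))
  /\ (forall (X Y : C) (u : corr E X Y), RDI_composite u ->
     exists (Z : C) (f : mor Z Y) (g : mor Z X) (a : E Z),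
       u = Rmap E f ⊚ Dmap E a ⊚ Imap E g)
  /\ (forall (X Y : C) (f : mor X Y) (a : E Y),
     Dmap E a ⊚ Rmap E f = Rmap E f ⊚ Dmap E (pull E f a))
  /\ (forall (X Y : C) (f : mor X Y) (a : E Y),
     Imap E f ⊚ Dmap E a = Dmap E (pull E f a) ⊚ Imap E f)
  /\ (forall (A B D P : C) (f : mor B D) (g : mor A D)
       (p : mor P B) (q : mor P A), is_pullback p q f g ->
     Imap E f ⊚ Rmap E g = Rmap E p ⊚ Imap E q)
  /\ (forall (X Y : C) (f : mor X Y) (a : E X),
     Rmap E f ⊚ Dmap E a ⊚ Imap E f = Dmap E (push E f a)).
Proof.
split; last (split; last (split; [|split; [|split]])).
- move=> X Y u; exists 1%N, (fun=> Y ⊠ X), (fun=> pr1), (fun=> pr2), (fun=> u).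
  by rewrite big_ord1 -corr_RDI.
- by move=> X Y u _; exists (Y ⊠ X), pr1, pr2, u; rewrite -corr_RDI.
- exact: Dmap_Rmap.
- exact: Imap_Dmap.
- exact: Imap_Rmap.
- exact: Rmap_Dmap_Imap_push.
Qed.
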